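(* Fix $L_d,L_q,V_h,\gamma,d>0$, $\varepsilon>0$ and $\omega_h=2\pi/\varepsilon$, let $L_0=\frac12(L_d+L_q)$, and let $i_{\alpha\beta}(t)\in\mathbb R^2$ be any (bounded, continuous) current signal. The estimator $$\hat y_v=\mathcal G_{\mathtt{grad}}\big[(\mathcal D_d-\mathcal Z_{2d})[i_{\alpha\beta}]\big],\qquad \hat\theta=\frac12\arctan\left\{\frac{\hat y_{v_2}}{\hat y_{v_1}-\frac{L_0}{L_dL_q}}\right\}$$ exactly coincides with the conventional high-pass/low-pass scheme $$y_h=\mathtt{HPF}[i_{\alpha\beta}],\qquad Y=(Y_\alpha, Y_\beta)^\top=\frac{2\omega_h}{V_h}L_dL_q\,\mathtt{LPF}\big[y_h\sin(\omega_ht+\phi)\big],\qquad \hat\theta=\frac12\arctan\left\{\frac{Y_\beta}{Y_\alpha-L_0}\right\}$$ when $\phi=\frac{3\pi}2$ and the filters are chosen as $$\mathtt{HPF}=\mathcal D_d-\mathcal Z_{2d},\qquad \mathtt{LPF}=\frac12\Big(\frac{V_h}{2\pi}\Big)^2\mathcal H .$$ That is, with corresponding (e.g. zero) filter initial conditions, $Y(t)=L_dL_q\,\hat y_v(t)$ for all $t$, and the two schemes produce the same angle estimate $\hat\theta$.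
   Context: All operators act componentwise on vector signals. With $S(t)=-\frac{V_h}{2\pi}\cos(\omega_ht)$: - Delay operator: $\mathcal D_d[u](t)=u(t-d)$. - Weighted zero-order hold operator: $\mathcal Z_w[u](t)=\frac1w[\chi(t)-\chi(t-w)]$ where $\dot\chi=u$. - Gradient operator: $\mathcal G_{\mathtt{grad}}[u]=\frac1\varepsilon x$, where $\dot x(t)=-\gamma S^2(t)x(t)+\gamma S(t)u(t)$. - Filter $\mathcal H$: $\mathcal H[u]=z$, where $\dot z(t)=-\gamma S^2(t)z(t)+\gamma u(t)$. *)

(* Defs.v *)
(* Stdlib real numbers with Coquelicot. *)
From Stdlib Require Import Reals ClassicalEpsilon.
From Coquelicot Require Import Coquelicot.

Open Scope R_scope.

Definition operator := (R -> R) -> (R -> R).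

Definition vsignal := R -> R * R.
Definition voperator := vsignal -> vsignal.

Definition componentwise (F1 F2 : operator) : voperator :=
  fun u t => (F1 (fun s => fst (u s)) t, F2 (fun s => snd (u s)) t).

Definition op_minus (F G : voperator) : voperator :=
  fun u t => minus (F u t) (G u t).

Definition op_scal (k : R) (F : voperator) : voperator :=
  fun u t => scal k (F u t).

Definition is_ode_solution (f : R -> R -> R) (x0 : R) (x : R -> R) : Prop :=
  x 0 = x0 /\ forall t : R, is_derive x t (f t (x t)).

(* The solution on the whole time axis of x' = f(t, x), x(0) = x0.  It is only
   used for right-hand sides that are affine in x, for which the solution is
   unique, and exists as soon as the coefficients are continuous. *)
Definition ode_solution (f : R -> R -> R) (x0 : R) : R -> R :=
  epsilon (inhabits (fun _ : R => 0)) (is_ode_solution f x0).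

Definition delay (d : R) : voperator :=
  let D : operator := fun u t => u (t - d) in
  componentwise D D.

(* The initial value of chi is immaterial: it cancels in the difference. *)
Definition zoh (w : R) : voperator :=
  let Z : operator := fun u t =>
    let chi := ode_solution (fun s _ => u s) 0 in
    1 / w * (chi t - chi (t - w)) in
  componentwise Z Z.

Definition Ssig (Vh omegah t : R) : R :=
  - (Vh / (2 * PI)) * cos (omegah * t).

(* [x0] is the initial value of the internal state x, not of the output. *)
Definition grad_op (Vh omegah gamma eps : R) (x0 : R * R) : voperator :=
  let G (x0 : R) : operator := fun u t =>
    let x := ode_solution
      (fun s x => - gamma * (Ssig Vh omegah s) ^ 2 * x
                  + gamma * Ssig Vh omegah s * u s) x0 in
    1 / eps * x t in
  componentwise (G (fst x0)) (G (snd x0)).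

Definition filterH (Vh omegah gamma : R) (z0 : R * R) : voperator :=
  let H (z0 : R) : operator := fun u =>
    ode_solution
      (fun s z => - gamma * (Ssig Vh omegah s) ^ 2 * z + gamma * u s) z0 in
  componentwise (H (fst z0)) (H (snd z0)).

Definition proposed_yv (Vh omegah gamma eps d : R) (x0 : R * R)
    (i : vsignal) : vsignal :=
  grad_op Vh omegah gamma eps x0 (op_minus (delay d) (zoh (2 * d)) i).

Definition proposed_theta (Ld Lq L0 : R) (yv : vsignal) (t : R) : R :=
  1 / 2 * atan (snd (yv t) / (fst (yv t) - L0 / (Ld * Lq))).

Definition conventional_Y (Ld Lq Vh omegah phi : R) (HPF LPF : voperator)
    (i : vsignal) : vsignal :=
  let yh := HPF i in
  op_scal (2 * omegah / Vh * (Ld * Lq)) LPF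
    (fun t => scal (sin (omegah * t + phi)) (yh t)).

Definition conventional_theta (L0 : R) (Y : vsignal) (t : R) : R :=
  1 / 2 * atan (snd (Y t) / (fst (Y t) - L0)).

(* Main.v *)
Require Import Defs.
From Stdlib Require Import Reals Lra ClassicalEpsilon.
From Coquelicot Require Import Coquelicot.
Open Scope R_scope.

(** Since [sin (w t + 3 PI / 2) = - cos (w t)], demodulation multiplies by
    [2 PI / Vh * S t].  So the input of the low-pass filter is [2 PI / Vh] times
    that of the gradient estimator, and both are driven by the same affine
    equation; by uniqueness the two states are proportional, with ratio
    [2 PI / Vh].  Existence of solutions matters as well, because [ode_solution]
    is unspecified without it; it comes from variation of constants, which needs
    the high-passed current to be continuous. *)

Lemma is_derive_RInt_from_0 (b : R -> R) (hb : forall t, continuous b t) (t : R) :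
  is_derive (fun s => RInt b 0 s) t (b t).
Proof.
  apply (is_derive_RInt b (fun s => RInt b 0 s) 0 t); [|apply hb].
  apply filter_forall. intros s.
  apply (RInt_correct b), (ex_RInt_continuous b). intros; apply hb.
Qed.

Lemma ode_solution_spec (f : R -> R -> R) (x0 : R) :
  (exists x, is_ode_solution f x0 x) -> is_ode_solution f x0 (ode_solution f x0).
Proof. intros H. unfold ode_solution. now apply epsilon_spec. Qed.

Lemma primitive_ode_solution (u : R -> R) (x0 : R) (hu : forall t, continuous u t) :
  is_ode_solution (fun s _ => u s) x0 (ode_solution (fun s _ => u s) x0).
Proof.
  apply ode_solution_spec. exists (fun t => x0 + RInt u 0 t). split.
  - rewrite RInt_point. apply Rplus_0_r.
  - intros t. rewrite <- (Rplus_0_l (u t)).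
    apply (is_derive_plus (fun _ => x0) (fun t => RInt u 0 t) t 0 (u t)).
    + apply (is_derive_const x0).
    + now apply is_derive_RInt_from_0.
Qed.

(** Variation of constants: with [A] the primitive of [a] vanishing at 0, a solution is [exp (A t)]
    times [x0] plus the integral from 0 to [t] of [exp (- A s) * b s]. *)
Lemma affine_ode_exists (a b : R -> R) (x0 : R)
  (ha : forall t, continuous a t) (hb : forall t, continuous b t) :
  exists x, is_ode_solution (fun s x => a s * x + b s) x0 x.
Proof.
  set (A := fun t => RInt a 0 t).
  assert (hA : forall t, is_derive A t (a t)) by now apply is_derive_RInt_from_0.
  set (c := fun t => exp (- A t) * b t).
  assert (hc : forall t, continuous c t).
  { intros t. apply (continuous_mult (fun t => exp (- A t)) b); [|apply hb].
    apply (ex_derive_continuous (V := R_NormedModule)). auto_derive. now exists (a t). }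
  assert (hC : forall t, is_derive (fun s => RInt c 0 s) t (c t))
    by now apply is_derive_RInt_from_0.
  set (C := fun t => RInt c 0 t) in hC.
  exists (fun t => exp (A t) * (x0 + C t)). split.
  - unfold A, C. rewrite !RInt_point. unfold zero; simpl. rewrite exp_0. ring.
  - intros t. auto_derive.
    + split; [now exists (a t) | split; [now exists (c t) | exact I]].
    + rewrite (is_derive_unique (fun r : R => A r) t _ (hA t)),
        (is_derive_unique (fun r : R => C r) t _ (hC t)).
      unfold c.
      (* The first [b t] comes from [c t] and carries [exp (A t) * exp (- A t)]; the second, from
         the equation, is given the same factor so that [ring] can close the goal. *)
      replace (b t) with (exp (A t) * exp (- A t) * b t) at 2.
      * ring.
      * rewrite <- exp_plus, Rplus_opp_r, exp_0. ring.
Qed.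

(** Integrating factor: the difference of two solutions solves the homogeneous equation, so its
    product with [exp (- A t)] has zero derivative, and it vanishes at 0. *)
Lemma affine_ode_unique (a b : R -> R) (x0 : R) (x y : R -> R)
  (ha : forall t, continuous a t)
  (hx : is_ode_solution (fun s x => a s * x + b s) x0 x)
  (hy : is_ode_solution (fun s x => a s * x + b s) x0 y) (t : R) :
  x t = y t.
Proof.
  destruct hx as [hx0 hx], hy as [hy0 hy].
  set (A := fun t => RInt a 0 t).
  assert (hA : forall t, is_derive A t (a t)) by now apply is_derive_RInt_from_0.
  set (g := fun t => exp (- A t) * (x t - y t)).
  assert (hg : forall s, is_derive g s 0).
  { intros s. unfold g. auto_derive.
    - repeat split; eexists; eauto.
    - rewrite (is_derive_unique (fun r : R => A r) s _ (hA s)),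
        (is_derive_unique (fun r : R => x r) s _ (hx s)),
        (is_derive_unique (fun r : R => y r) s _ (hy s)). ring. }
  assert (hg0 : g t = g 0).
  (* [eq_is_derive] compares the ends of an interval given in increasing order, hence the split on
     the sign of [t]. *)
  { destruct (Rtotal_order t 0) as [ht | [-> | ht]]; [|reflexivity|symmetry];
      apply (eq_is_derive g); auto. }
  unfold g in hg0. rewrite hx0, hy0, Rminus_diag, Rmult_0_r in hg0.
  apply Rmult_integral in hg0. pose proof (exp_pos (- A t)). lra.
Qed.

(** By linearity, [k] times the solution for [b] solves the scaled problem; uniqueness identifies it
    with the solution that [epsilon] selects there. *)
Lemma affine_ode_solution_scal (a b b' : R -> R) (k x0 : R)
  (ha : forall t, continuous a t) (hb : forall t, continuous b t)
  (hb' : forall t, b' t = k * b t) (t : R) :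
  ode_solution (fun s x => a s * x + b' s) (k * x0) t =
  k * ode_solution (fun s x => a s * x + b s) x0 t.
Proof.
  destruct (ode_solution_spec _ _ (affine_ode_exists a b x0 ha hb)) as [h0 h].
  set (x := ode_solution (fun s x => a s * x + b s) x0) in *.
  assert (hkx : is_ode_solution (fun s x => a s * x + b' s) (k * x0)
                  (fun t => k * x t)).
  { split; [now rewrite h0|]. intros s. rewrite hb'.
    replace (a s * (k * x s) + k * b s) with (k * (a s * x s + b s)) by ring.
    now apply (is_derive_scal x s k). }
  apply (affine_ode_unique a b' (k * x0) _ (fun t => k * x t) ha); [|exact hkx].
  apply ode_solution_spec. now exists (fun t => k * x t).
Qed.

(** Makes the high-passed current an admissible input of the affine equations: [chi] is a genuine
    primitive of [u], hence continuous. *)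
Lemma continuous_delay_minus_zoh (d w : R) (u : R -> R) (hu : forall t, continuous u t)
  (t : R) :
  let chi := ode_solution (fun s _ => u s) 0 in
  continuous (fun s => minus (u (s - d)) (1 / w * (chi s - chi (s - w)))) t.
Proof.
  intros chi.
  assert (hchi : forall s, continuous chi s).
  { intros s. apply (ex_derive_continuous (V := R_NormedModule)). exists (u s).
    apply (primitive_ode_solution u 0 hu). }
  assert (hshift : forall c, continuous (fun s => s - c) t).
  { intros c. apply (continuous_minus (fun s : R => s) (fun _ => c));
      [apply continuous_id | apply continuous_const]. }
  apply (continuous_minus (fun s => u (s - d)) (fun s => 1 / w * (chi s - chi (s - w)))).
  - apply (continuous_comp (fun s => s - d) u); auto.
  - apply (continuous_mult (fun _ => 1 / w) (fun s => chi s - chi (s - w)));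
      [apply continuous_const|].
    apply (continuous_minus chi (fun s => chi (s - w))); [apply hchi|].
    apply (continuous_comp (fun s => s - w) chi); auto.
Qed.

Lemma continuous_Ssig (Vh omegah t : R) : continuous (Ssig Vh omegah) t.
Proof. apply (ex_derive_continuous (V := R_NormedModule)). unfold Ssig. now auto_derive. Qed.

Lemma sin_shift_3PI2 (x : R) : sin (x + 3 * PI / 2) = - cos x.
Proof.
  replace (x + 3 * PI / 2) with (PI / 2 + (x + PI)) by field.
  now rewrite <- cos_sin, neg_cos.
Qed.

(** The carrier [sin (omegah * s + 3 * PI / 2)] equals [2 * PI / Vh * Ssig Vh omegah s], so forcing
    term and initial state are both scaled by [2 * PI / Vh]. *)
Lemma demodulated_filterH (Vh omegah gamma x0 : R) (v : R -> R) (hVh : 0 < Vh)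
  (hv : forall t, continuous v t) (t : R) :
  ode_solution
    (fun s z => - gamma * (Ssig Vh omegah s) ^ 2 * z
                + gamma * (sin (omegah * s + 3 * PI / 2) * v s))
    (2 * PI / Vh * x0) t =
  2 * PI / Vh *
  ode_solution
    (fun s x => - gamma * (Ssig Vh omegah s) ^ 2 * x
                + gamma * Ssig Vh omegah s * v s) x0 t.
Proof.
  assert (hS := continuous_Ssig Vh omegah).
  apply (affine_ode_solution_scal (fun s => - gamma * (Ssig Vh omegah s) ^ 2)
           (fun s => gamma * Ssig Vh omegah s * v s)
           (fun s => gamma * (sin (omegah * s + 3 * PI / 2) * v s))).
  - intros s. apply (ex_derive_continuous (V := R_NormedModule)). unfold Ssig. now auto_derive.
  - intros s. apply (continuous_mult (fun s => gamma * Ssig Vh omegah s) v); [|apply hv].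
    apply (continuous_mult (fun _ => gamma) (Ssig Vh omegah));
      [apply continuous_const | apply hS].
  - intros s. rewrite sin_shift_3PI2. unfold Ssig. field.
    pose proof PI_RGT_0. lra.
Qed.

(* Also true when [p = c / k]: both quotients are then [0], as [/ 0 = 0]. *)
Lemma div_minus_scal (k p q c : R) (hk : k <> 0) :
  k * q / (k * p - c) = q / (p - c / k).
Proof.
  replace (k * p - c) with (k * (p - c / k)) by now field.
  unfold Rdiv at 1. rewrite Rinv_mult. unfold Rdiv.
  set (r := / (p - c * / k)). now field.
Qed.

Theorem mainTheorem3
  (Ld Lq Vh gamma d eps omegah L0 phi : R)
  (hLd : 0 < Ld) (hLq : 0 < Lq) (hVh : 0 < Vh) (hgamma : 0 < gamma)
  (hd : 0 < d) (heps : 0 < eps)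
  (homegah : omegah = 2 * PI / eps)
  (hL0 : L0 = 1 / 2 * (Ld + Lq))
  (hphi : phi = 3 * PI / 2)
  (i : vsignal)
  (hi_cont : forall t : R, continuous i t)
  (hi_bdd : exists M : R, forall t : R, norm (i t) <= M)
  (* corresponding initial states of the two filters; both may be zero *)
  (x0 z0 : R * R) (hinit : z0 = scal (2 * PI / Vh) x0)
  (HPF LPF : voperator)
  (hHPF : HPF = op_minus (delay d) (zoh (2 * d)))
  (hLPF : LPF = op_scal (1 / 2 * (Vh / (2 * PI)) ^ 2)
                        (filterH Vh omegah gamma z0)) :
  let yv := proposed_yv Vh omegah gamma eps d x0 i in
  let Y := conventional_Y Ld Lq Vh omegah phi HPF LPF i in
  forall t : R,
    Y t = scal (Ld * Lq) (yv t) /\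
    conventional_theta L0 Y t = proposed_theta Ld Lq L0 yv t.
Proof.
  intros yv Y t.
  assert (hLL : Ld * Lq <> 0) by (apply Rgt_not_eq, Rmult_lt_0_compat; assumption).
  assert (hY : Y t = scal (Ld * Lq) (yv t)).
  { pose proof PI_RGT_0 as hPI.
    assert (hi1 : forall s, continuous (fun s => fst (i s)) s)
      by (intros s; apply (continuous_comp i fst); [apply hi_cont | apply continuous_fst]).
    assert (hi2 : forall s, continuous (fun s => snd (i s)) s)
      by (intros s; apply (continuous_comp i snd); [apply hi_cont | apply continuous_snd]).
    assert (h1 := fun s => continuous_delay_minus_zoh d (2 * d) _ hi1 s).
    assert (h2 := fun s => continuous_delay_minus_zoh d (2 * d) _ hi2 s).
    assert (hcomp : forall (v : R -> R) (x0 : R), (forall s, continuous v s) ->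
      2 * omegah / Vh * (Ld * Lq) * (1 / 2 * (Vh / (2 * PI)) ^ 2 *
        ode_solution
          (fun s z => - gamma * (Ssig Vh omegah s) ^ 2 * z
                      + gamma * (sin (omegah * s + 3 * PI / 2) * v s))
          (2 * PI / Vh * x0) t) =
      Ld * Lq * (1 / eps *
        ode_solution
          (fun s x => - gamma * (Ssig Vh omegah s) ^ 2 * x
                      + gamma * Ssig Vh omegah s * v s) x0 t)).
    { intros v x1 hv. rewrite demodulated_filterH by assumption.
      (* The gains collapse: [2 * omegah / Vh * (1 / 2) * (Vh / (2 * PI)) ^ 2 * (2 * PI / Vh)] is
         [omegah / (2 * PI)], that is [1 / eps]. *)
      set (x := ode_solution _ _ t). rewrite homegah. field. lra. }
    unfold Y, yv. subst HPF LPF z0 phi.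
    (* Each component of the two outputs unfolds to [hcomp], with [v] the corresponding component of
       the high-passed current. *)
    apply injective_projections;
      [exact (hcomp _ (fst x0) h1) | exact (hcomp _ (snd x0) h2)]. }
  split; [exact hY|].
  unfold conventional_theta, proposed_theta. rewrite hY.
  (* The common factor [Ld * Lq] cancels in the quotient, turning the offset [L0] into
     [L0 / (Ld * Lq)]. *)
  change (1 / 2 * atan (Ld * Lq * snd (yv t) / (Ld * Lq * fst (yv t) - L0)) =
          1 / 2 * atan (snd (yv t) / (fst (yv t) - L0 / (Ld * Lq)))).
  now rewrite div_minus_scal.
Qed.
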